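(* Consider the planted submatrix problem with $\rho\le1/2$. Let $k\ge0$ be an integer, $D=2k+1$, and $f(Y)=\tau_k(Y_{11}/\lambda)$. For any $0<r<1$, if $\lambda\ge\frac{12}{r}\sqrt{\log4+2D\log(9/\rho)}$, then $\mathbb{E}(f(Y)-x)^2\le D^2r^{D-1}$.
   Context: Planted submatrix problem: observe $Y=\lambda vv^\top+W$ ($n\times n$), where $v\in\{0,1\}^n$ has i.i.d. $\mathrm{Bernoulli}(\rho)$ entries, $W$ is symmetric with $W_{ij}=W_{ji}\sim\mathcal{N}(0,1)$ for $i<j$, $W_{ii}\sim\mathcal{N}(0,2)$, the $\{W_{ij}:i\le j\}$ independent and independent of $v$; $\lambda>0$, $\rho\in(0,1)$; target $x=v_1$. $\tau_k(y)=(2k+1)\binom{2k}{k}\int_0^yt^k(1-t)^k\,dt$, a polynomial of degree $2k+1$. Logarithms are natural. *)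

(* Defs.v *)
From HB Require Import structures.
From mathcomp Require Import all_boot all_order all_algebra.
From mathcomp Require Import all_classical all_reals all_analysis.
Set Implicit Arguments. Unset Strict Implicit. Unset Printing Implicit Defensive.
Import Order.TTheory GRing.Theory Num.Theory.
Import numFieldNormedType.Exports.
Local Open Scope classical_set_scope.
Local Open Scope ring_scope.

Definition tau_integrand {R : realType} (k : nat) (t : R) : R :=
  t ^+ k * (1 - t) ^+ k.

Definition tau {R : realType} (k : nat) (y : R) : R :=
  ((2 * k + 1) * 'C(2 * k, k))%:R *
  (if 0 <= y then Rintegral lebesgue_measure `[0, y] (tau_integrand k)
   else - Rintegral lebesgue_measure `[y, 0] (tau_integrand k)).

Definition has_law {d} {T : measurableType d} {R : realType}
  (P : probability T R) (X : T -> R) (mu : set R -> \bar R) : Prop :=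
  measurable_fun setT X /\
  forall A : set R, measurable A -> P (X @^-1` A) = mu A.

Definition bernoulli_law {R : realType} (rho : R) (A : set R) : \bar R :=
  (rho%:E * \d_(1%R : R) A + (1 - rho)%R%:E * \d_(0%R : R) A)%E.

Definition mutually_independent {d} {T : measurableType d} {R : realType}
  (P : probability T R) {I : eqType} (D : pred I) (X : I -> T -> R) : Prop :=
  forall (s : seq I) (B : I -> set R),
    uniq s -> all D s -> (forall i, measurable (B i)) ->
    P (\bigcap_(i in [set i | i \in s]) (X i @^-1` B i)) =
    (\prod_(i <- s) P (X i @^-1` B i))%E.

Definition psm_index (n : nat) : pred ('I_n + ('I_n * 'I_n)) :=
  fun a => match a with inl _ => true | inr ij => (ij.1 <= ij.2)%N end.

Definition psm_family {T R : Type} (n : nat) (v : 'I_n -> T -> R)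
  (W : 'I_n -> 'I_n -> T -> R) : 'I_n + ('I_n * 'I_n) -> T -> R :=
  fun a => match a with inl i => v i | inr ij => W ij.1 ij.2 end.

Definition planted_submatrix_model {d} {T : measurableType d} {R : realType}
  (P : probability T R) (n : nat) (rho : R)
  (v : 'I_n -> T -> R) (W : 'I_n -> 'I_n -> T -> R) : Prop :=
  [/\ forall i, has_law P (v i) (bernoulli_law rho),
      forall i j : 'I_n, (i < j)%N -> has_law P (W i j) (normal_prob 0 1),
      forall i, has_law P (W i i) (normal_prob 0 (Num.sqrt 2)),
      forall (i j : 'I_n) w, W i j w = W j i w &
      mutually_independent P (@psm_index n) (psm_family v W)].

Definition obsY {T : Type} {R : realType} {n : nat} (lambda : R) (v : 'I_n -> T -> R)
  (W : 'I_n -> 'I_n -> T -> R) (i j : 'I_n) (w : T) : R :=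
  (lambda * v i w * v j w + W i j w)%R.

(* Main.v *)
Require Import Defs.
From HB Require Import structures.
From mathcomp Require Import all_boot all_order all_algebra.
From mathcomp Require Import all_classical all_reals all_analysis.
From mathcomp Require Import measurable_realfun zify ring lra.
Set Implicit Arguments. Unset Strict Implicit. Unset Printing Implicit Defensive.
Import Order.TTheory GRing.Theory Num.Theory.
Import numFieldNormedType.Exports.
Local Open Scope classical_set_scope.
Local Open Scope ring_scope.

(** Writing g = W_11 / lambda, the observation is Y_11 / lambda = x + g because x = v_1 is 0 or 1 almost surely.
    The polynomial tau_k fixes 0 and 1 and its derivative has a zero of order k at both points, so by the mean value
    theorem the error is at most a constant times |g|^(k+1) (1 + |g|)^k. The resulting moments of g are absorbed by
    exp(W_11^2 / 8), whose expectation is sqrt 2; the constants 16^k from the binomial coefficient and 4^k from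
    (1 + |g|)^(2k) are beaten by the factor (r^2 / 72)^(k+1) that the lower bound on lambda provides. *)

(** * The polynomial tau_k near its fixed points 0 and 1 *)

Lemma poly_primitive {R : numFieldType} (p : {poly R}) :
  exists q : {poly R}, q^`() = p.
Proof.
exists (\poly_(i < (size p).+1) (p`_i.-1 / i%:R)).
apply/polyP => i; rewrite coef_deriv coef_poly ltnS.
case: ltnP => [_|pi]; last by rewrite mul0rn nth_default.
by rewrite -[_ *+ i.+1]mulr_natr divfK// pnatr_eq0.
Qed.

Lemma Rintegral_horner_deriv {R : realType} (q : {poly R}) (a b : R) :
  a <= b ->
  Rintegral lebesgue_measure `[a, b] (horner q^`()) = q.[b] - q.[a].
Proof.
rewrite le_eqVlt => /predU1P[->|ab].
  by rewrite set_itv1 Rintegral_set1 subrr.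
rewrite /Rintegral (continuous_FTC2 (F := horner q))//=.
- exact/continuous_subspaceT/continuous_horner.
- split; first by move=> x _; exact: derivable_horner.
  + exact/cvg_at_right_filter/continuous_horner.
  + exact/cvg_at_left_filter/continuous_horner.
- by move=> x _; rewrite derivE.
Qed.

(** This is the Beta integral B(k+1, k+1) = k!^2 / (2k+1)!; it explains the normalising constant of
    [tau]. *)
Lemma Rintegral_tau_integrand {R : realType} (k : nat) :
  Rintegral lebesgue_measure `[0, 1] (@tau_integrand R k) =
  ((2 * k + 1) * 'C(2 * k, k))%:R^-1.
Proof.
have -> : Rintegral lebesgue_measure `[0, 1] (@tau_integrand R k) =
    beta_fun k.+1 k.+1.
  rewrite /beta_fun [LHS]Rintegral_mkcond; apply: eq_Rintegral => x _.
  by [].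
rewrite beta_fun_fact addnn -mul2n addn1.
have := bin_fact (leq_pmull k (isT : 0 < 2)%N).
rewrite [X in (X - k)%N]mulSn mul1n addnK => kE.
rewrite factS -kE mulnA [X in _ / X]natrM invfM mulrCA divff ?mulr1//.
Qed.

(** By the fundamental theorem of calculus both branches of the signed integral equal q(y) - q(0)
    for one primitive q, so [tau] inherits measurability and the mean value theorem from
    polynomials. *)
Lemma tau_horner {R : realType} (k : nat) :
  exists2 q : {poly R},
    q^`() = ((2 * k + 1) * 'C(2 * k, k))%:R *: ('X^k * (1 - 'X) ^+ k) &
    tau k =1 horner q.
Proof.
set c := ((2 * k + 1) * 'C(2 * k, k))%:R.
have [q qE] := poly_primitive ('X^k * (1 - 'X) ^+ k : {poly R}).
exists (c *: (q - q.[0]%:P)).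
  by rewrite derivZ derivB derivC subr0 qE.
have -> : @tau R k = fun y => c * (if 0 <= y
    then Rintegral lebesgue_measure `[0, y] (horner q^`())
    else - Rintegral lebesgue_measure `[y, 0] (horner q^`())).
  suff -> : horner q^`() = tau_integrand k by [].
  by apply/funext => t; rewrite qE !hornerE.
move=> y /=; rewrite !hornerE; congr (_ * _).
case: leP => y0; first by rewrite Rintegral_horner_deriv.
by rewrite Rintegral_horner_deriv ?opprB// ltW.
Qed.

Lemma tau0 {R : realType} (k : nat) : @tau R k 0 = 0.
Proof. by rewrite /tau lexx set_itv1 Rintegral_set1 mulr0. Qed.

Lemma tau1 {R : realType} (k : nat) : @tau R k 1 = 1.
Proof.
rewrite /tau ler01 Rintegral_tau_integrand divff//.
by rewrite pnatr_eq0 -lt0n muln_gt0 bin_gt0; lia.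
Qed.

Lemma measurable_tau {R : realType} (k : nat) :
  measurable_fun setT (@tau R k).
Proof.
have [q _ tauE] := @tau_horner R k.
apply: (eq_measurable_fun (horner q)) => [y _|]; first by rewrite tauE.
exact: measurable_poly.
Qed.

Lemma tau_MVT {R : realType} (k : nat) (x y : R) :
  exists2 t, `|t - x| <= `|y - x| &
    tau k y - tau k x =
      ((2 * k + 1) * 'C(2 * k, k))%:R * tau_integrand k t * (y - x).
Proof.
have [q qE tauE] := @tau_horner R k.
have dq z : q^`().[z] = ((2 * k + 1) * 'C(2 * k, k))%:R * tau_integrand k z.
  by rewrite qE !hornerE.
rewrite !tauE.
(* The identity is antisymmetric in x and y, so an ordered pair suffices; the intermediate point is
   kept only through its distance to x, which covers both orders. *)
wlog suff H : x y / x <= y ->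
    exists2 t, t \in `[x, y] & q.[y] - q.[x] = q^`().[t] * (y - x).
  have [xy|/ltW yx] := leP x y.
  - have [t] := H _ _ xy; rewrite in_itv/= => /andP[xt ty] ->.
    by exists t; rewrite ?dq// !ger0_norm ?subr_ge0// lerD2r.
  - have [t] := H _ _ yx; rewrite in_itv/= => /andP[yt tx] qxy.
    exists t; last by rewrite -dq -opprB qxy -mulrN opprB.
    by rewrite !ler0_norm ?subr_le0// lerN2 lerD2r.
move=> xy; apply: MVT_segment => //.
exact/continuous_subspaceT/continuous_horner.
Qed.

(* One of the factors |t|, |1 - t| of the derivative is at most |y - x|. *)
Lemma tau_dist {R : realType} (k : nat) (x y : R) : x = 0 \/ x = 1 ->
  `|tau k y - x| <= ((2 * k + 1) * 'C(2 * k, k))%:R *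
    (`|y - x| ^+ k.+1 * (1 + `|y - x|) ^+ k).
Proof.
move=> x01; have [t tx] := tau_MVT k x y.
have -> : tau k x = x by case: x01 => ->; rewrite ?tau0 ?tau1.
move=> ->; rewrite 2!normrM normr_nat -mulrA ler_wpM2l//.
rewrite exprSr mulrAC ler_wpM2r// /tau_integrand normrM !normrX.
case: x01 tx => -> tx.
- rewrite ler_pM ?exprn_ge0// ?lerXn2r ?nnegrE ?addr_ge0//.
    by move: tx; rewrite !subr0.
  rewrite (le_trans (ler_normB _ _))// normr1 lerD2l.
  by move: tx; rewrite !subr0.
- rewrite mulrC ler_pM ?exprn_ge0// ?lerXn2r ?nnegrE ?addr_ge0//.
    by rewrite distrC.
  by rewrite -[t in `|t|](subrK 1) addrC (le_trans (ler_normD _ _))// normr1 lerD2l.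
Qed.

(** * Expectations under the normal and Bernoulli laws *)

Lemma integral_normal_prob {R : realType} (m s : R) (f : R -> \bar R) :
  (forall x, 0 <= f x)%E -> measurable_fun [set: R] f ->
  (\int[normal_prob m s]_x f x =
   \int[lebesgue_measure]_x (f x * (normal_pdf m s x)%:E))%E.
Proof.
move=> f0 mf.
have dom := normal_prob_dominates m s.
have mpdf : measurable_fun setT (EFin \o normal_pdf m s).
  by apply/measurable_EFinP; exact: measurable_normal_pdf.
have intf := Radon_Nikodym_SigmaFinite.f_integrable dom.
rewrite -(Radon_Nikodym_SigmaFinite.change_of_variables dom)//.
apply: ae_eq_integral => //.
- exact: emeasurable_funM (measurable_int _ intf).
- exact: emeasurable_funM.
(* The Radon-Nikodym derivative and the density have equal integrals over every measurable set,
   hence agree almost everywhere. *)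
apply: ae_eqe_mul2l; apply: integral_ae_eq => // E _ mE.
by rewrite -Radon_Nikodym_SigmaFinite.f_integral.
Qed.

(* The factor exp(x^2 / 4 s^2) turns the density of N(0, s^2) into a multiple of the density of N(0, 2 s^2). *)
Lemma integral_normal_expR_sqr {R : realType} (s : R) : s != 0 ->
  (\int[normal_prob 0 s]_x (expR (x ^+ 2 / (4 * s ^+ 2)))%:E =
   (Num.sqrt 2)%:E)%E.
Proof.
move=> s0.
have s20 : Num.sqrt 2 * s != 0 by rewrite mulf_neq0// gt_eqF// sqrtr_gt0.
rewrite integral_normal_prob; last 2 first.
- by move=> x; rewrite lee_fin expR_ge0.
- apply/measurable_EFinP/measurableT_comp => //.
  by apply: measurable_funM => //; exact: measurable_funX.
transitivity (\int[lebesgue_measure]_x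
    ((Num.sqrt 2)%:E * (normal_pdf 0 (Num.sqrt 2 * s) x)%:E))%E.
  apply: eq_integral => x _; rewrite -!EFinM; congr EFin.
  rewrite !normal_pdfE// /normal_peak /normal_fun !subr0 mulrCA [RHS]mulrA.
  congr (_ * _).
    rewrite exprMn sqr_sqrtr// -[in RHS]mulrA -[in RHS]mulrnAr [in RHS]sqrtrM// invfM.
    by rewrite mulrA divff ?mul1r.
  rewrite -expRD; congr expR; rewrite exprMn sqr_sqrtr//.
  by field.
rewrite integralZl//; last exact: integrable_normal_pdf.
by rewrite integral_normal_pdf mule1.
Qed.

Lemma has_law_integral {d} {T : measurableType d} {R : realType}
    (P : probability T R) (X : T -> R) (mu : {measure set (measurableTypeR R) -> \bar R})
    (f : R -> \bar R) :
  has_law P X mu -> (forall x, 0 <= f x)%E -> measurable_fun [set: R] f ->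
  (\int[P]_w f (X w) = \int[mu]_x f x)%E.
Proof.
move=> [mX PX] f0 mf.
transitivity (\int[pushforward P (X : T -> measurableTypeR R)]_x f x)%E.
  by rewrite (ge0_integral_pushforward (Y := measurableTypeR R) mX).
by apply: eq_measure_integral => A mA _; exact: PX.
Qed.

(** [has_law] constrains only the distribution, so the values 0 and 1 are certain only up to a null
    set: both Dirac masses vanish on the complement of {0, 1}. *)
Lemma bernoulli_law_ae {d} {T : measurableType d} {R : realType}
    (P : probability T R) (X : T -> R) (rho : R) :
  has_law P X (bernoulli_law rho) -> {ae P, forall w, X w = 0 \/ X w = 1}.
Proof.
move=> [mX PX]; exists (X @^-1` ~` [set 0; 1]); split.
- rewrite -[X in measurable X]setTI; apply: mX => //.
  exact/measurableC/measurableU.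
- rewrite PX; last exact/measurableC/measurableU.
  rewrite /bernoulli_law !diracE !memNset ?mule0 ?adde0//=.
  + by apply; left.
  + by apply; right.
- by move=> w; apply: contra_not => /= -[] //; tauto.
Qed.

(** * Elementary inequalities and the pointwise error bound *)

Lemma bin_leq_exp2 (n m : nat) : ('C(n, m) <= 2 ^ n)%N.
Proof.
elim: n m => [|n IH] [|m]; rewrite ?bin0 ?expn_gt0// binS.
by rewrite expnS mul2n -addnn leq_add.
Qed.

(** Raise x/D <= exp(x/D) to the power m and use m/D <= 1. The constant D^m, rather than m^m, is
    what cancels against the factor D in the hypothesis of [tau_bound_le_expR]. *)
Lemma exprn_le_expR {R : realType} (D m : nat) (x : R) :
  (m <= D)%N -> 0 <= x -> x ^+ m <= D%:R ^+ m * expR x.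
Proof.
case: D => [|D mD x0].
  by rewrite leqn0 => /eqP-> x0; rewrite !expr0 mul1r -expR0 ler_expR.
have xD : x <= D.+1%:R * expR (x / D.+1%:R).
  rewrite -ler_pdivrMl ?ltr0n// mulrC.
  by rewrite (le_trans _ (expR_ge1Dx _))// lerDr.
apply: (le_trans (lerXn2r m _ _ xD)); rewrite ?nnegrE ?mulr_ge0 ?expR_ge0//.
rewrite exprMn ler_wpM2l ?exprn_ge0// -expRM_natl ler_expR.
by rewrite mulrCA ler_piMr// ler_pdivrMr ?ltr0n// mul1r ler_nat.
Qed.

(** Since 1 + s <= 2 max(1, s), each case leaves a pure power of s to bound. *)
Lemma exprD1_le {R : realFieldType} (k : nat) (s : R) : 0 <= s ->
  (1 + s) ^+ (2 * k) <= 4 ^+ k \/ (1 + s) ^+ (2 * k) <= 4 ^+ k * s ^+ (2 * k).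
Proof.
move=> s0; rewrite exprM [s ^+ _]exprM -exprMn.
have [s1|s1] := leP s 1; [left|right];
  by apply: lerXn2r; rewrite ?nnegrE; nra.
Qed.

(* Applied with s = |w| / lambda and b = w^2 / 8, the exponent that the N(0, 2) tail absorbs. *)
Lemma tau_bound_le_expR {R : realType} (k : nat) (s b r : R) :
  0 <= s -> 0 <= b -> 0 <= r -> r <= 1 ->
  s ^+ 2 * (2 * k + 1)%:R <= r ^+ 2 / 72 * b ->
  (((2 * k + 1) * 'C(2 * k, k))%:R * (s ^+ k.+1 * (1 + s) ^+ k)) ^+ 2 <=
  (2 * k + 1)%:R ^+ 2 * r ^+ (2 * k) / 72 * expR b.
Proof.
set D := (2 * k + 1)%N.
have [kD kkD] : (k < D)%N /\ (k.+1 + k <= D)%N by rewrite /D; split; lia.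
set a := r ^+ 2 / 72 => s0 b0 r0 r1 sb.
have D0 : 0 < D%:R :> R by rewrite ltr0n /D addn1.
have r21 : r ^+ 2 <= 1 by exact: exprn_ile1.
have [a0 a72 a64] : [/\ 0 <= a, a <= 72^-1 & 16 * 4 * a <= r ^+ 2].
  by rewrite /a; have := sqr_ge0 r; split; lra.
have a1 : a <= 1 by lra.
clearbody a.
(* From s^2 D <= a b, s^(2m) D^m <= (a b)^m <= a^m D^m exp(b); cancel D^m, then a^m <= a^(k+1)
   because a <= 1. *)
have moment m : (k < m)%N -> (m <= D)%N ->
    s ^+ (2 * m) <= a ^+ k.+1 * expR b.
  move=> km mD; apply: (@le_trans _ _ (a ^+ m * expR b)); last first.
    by rewrite ler_wpM2r ?expR_ge0// ler_wiXn2l.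
  rewrite -(@ler_pM2r _ (D%:R ^+ m)) ?exprn_gt0// exprM -exprMn.
  apply: le_trans (_ : (a * b) ^+ m <= _).
    by apply: lerXn2r; rewrite ?nnegrE ?mulr_ge0 ?sqr_ge0 ?(ltW D0).
  rewrite exprMn -mulrA ler_wpM2l ?exprn_ge0// mulrC.
  exact: exprn_le_expR.
have C0 : 0 <= 'C(2 * k, k)%:R :> R by exact: ler0n.
have C16 : 'C(2 * k, k)%:R ^+ 2 <= 16 ^+ k :> R.
  have -> : 16 ^+ k = ((2 ^ (2 * k))%:R ^+ 2 : R).
    by rewrite natrX exprAC exprM -!natrX.
  by apply: lerXn2r; rewrite ?nnegrE ?ler0n// ler_nat bin_leq_exp2.
have poly_le : s ^+ (2 * k.+1) * (1 + s) ^+ (2 * k) <=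
    4 ^+ k * (a ^+ k.+1 * expR b).
  (* The two cases need the moments m = k+1 and m = 2k+1, the two ends of the allowed range. *)
  have [h|h] := exprD1_le k s0.
    rewrite mulrC ler_pM ?exprn_ge0 ?addr_ge0//.
    exact: moment.
  apply: (le_trans (ler_wpM2l _ h)); first exact: exprn_ge0.
  rewrite mulrCA -exprD ler_wpM2l ?exprn_ge0// -mulnDr.
  by apply: moment; rewrite // addSn ltnS leq_addl.
(* Of the k+1 factors a, k are spent in (16 * 4 * a)^k <= r^(2k), and the last gives 1/72. *)
have aE : 16 ^+ k * (4 ^+ k * a ^+ k.+1) <= r ^+ (2 * k) / 72.
  rewrite exprSr !mulrA -!exprMn exprM.
  apply: ler_pM; rewrite ?exprn_ge0 ?mulr_ge0//.
  by apply: lerXn2r; rewrite ?nnegrE ?mulr_ge0 ?sqr_ge0.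
have -> : ((D * 'C(2 * k, k))%:R * (s ^+ k.+1 * (1 + s) ^+ k)) ^+ 2 =
    D%:R ^+ 2 * ('C(2 * k, k)%:R ^+ 2 *
      (s ^+ (2 * k.+1) * (1 + s) ^+ (2 * k))).
  rewrite natrM !exprMn (mulnC 2 k.+1) (mulnC 2 k).
  by rewrite [in RHS](exprM s) [in RHS](exprM (1 + s)) -mulrA.
rewrite -[_ / 72]mulrA -[leRHS]mulrA ler_wpM2l ?exprn_ge0//.
apply: (le_trans (ler_pM _ _ C16 poly_le)); rewrite ?mulr_ge0 ?exprn_ge0 ?addr_ge0//.
by rewrite mulrA mulrA ler_wpM2r ?expR_ge0// -mulrA.
Qed.

(** The fourth power of exp(-1/2) >= 1 - 1/2 gives exp(2) <= 16. *)
Lemma ln_ge2 {R : realType} (x : R) : 16 <= x -> 2 <= ln x.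
Proof.
move=> x16; rewrite -ler_expR lnK ?posrE; last by lra.
apply: le_trans x16.
have h : 2^-1 <= expR (- 2^-1 : R).
  by rewrite (le_trans _ (expR_ge1Dx _))//; lra.
have e2 : expR 2 = (expR (- 2^-1 : R) ^+ 4)^-1.
  by rewrite -expRM_natl -expRN; congr expR; field.
rewrite e2 invf_ple ?posrE ?exprn_gt0 ?expR_gt0//.
have -> : 16^-1 = (2^-1 : R) ^+ 4 by field.
by apply: lerXn2r; rewrite ?nnegrE ?expR_ge0 ?invr_ge0.
Qed.

Lemma sqr_snr_ge {R : realType} (k : nat) (lambda rho r : R) :
  0 < rho -> rho <= 1 / 2 -> 0 < r ->
  12 / r * Num.sqrt (ln 4 + 2 * (2 * k + 1)%:R * ln (9 / rho)) <= lambda ->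
  576 * (2 * k + 1)%:R <= r ^+ 2 * lambda ^+ 2.
Proof.
move=> rho0 rho12 r0; set D := (2 * k + 1)%:R => lrho.
have D0 : 0 <= D :> R by exact: ler0n.
have ln4 : 0 <= ln 4 :> R by apply: ln_ge0; lra.
have ln9 : 2 <= ln (9 / rho).
  by apply: ln_ge2; rewrite ler_pdivlMr//; lra.
(* Here 9/rho >= 18, so the logarithm is at least 2; squaring below turns this 4 into 576 = 12^2 *
   4. *)
have D4 : 4 * D <= ln 4 + 2 * D * ln (9 / rho) by nra.
set S := ln 4 + _ in lrho D4.
have S0 : 0 <= S by lra.
have rl : 12 * Num.sqrt S <= r * lambda.
  have := ler_wpM2l (ltW r0) lrho.
  by rewrite !mulrA [r * 12]mulrC mulfK ?gt_eqF.
have : (12 * Num.sqrt S) ^+ 2 <= (r * lambda) ^+ 2.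
  have s0 : 0 <= 12 * Num.sqrt S by rewrite mulr_ge0.
  by apply: lerXn2r => //; rewrite nnegrE (le_trans s0).
by rewrite !exprMn sqr_sqrtr// => rl2; nra.
Qed.

Theorem mainTheorem11 (R : realType) (d : measure_display) (T : measurableType d)
  (P : probability T R) (n : nat) (lambda rho : R)
  (v : 'I_n.+1 -> T -> R) (W : 'I_n.+1 -> 'I_n.+1 -> T -> R)
  (k : nat) (r : R) :
  0 < lambda -> 0 < rho -> rho <= 1 / 2 ->
  planted_submatrix_model P rho v W ->
  0 < r -> r < 1 ->
  12 / r * Num.sqrt (ln 4 + 2 * (2 * k + 1)%:R * ln (9 / rho)) <= lambda ->
  ('E_P[fun w => ((tau k (obsY lambda v W ord0 ord0 w / lambda) - v ord0 w) ^+ 2)%R]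
     <= ((2 * k + 1)%:R ^+ 2 * r ^+ (2 * k))%:E)%E.
Proof.
move=> l0 rho0 rho12 [vlaw _ Wlaw _ _] r0 r1 lrho.
have lD := sqr_snr_ge rho0 rho12 r0 lrho.
set D := (2 * k + 1)%:R : R in lD *.
set v0 := v ord0; set w0 := W ord0 ord0.
have [mv _] := vlaw ord0; have [mw _] := Wlaw ord0.
have mY : measurable_fun setT (obsY lambda v W ord0 ord0).
  by apply: measurable_funD => //; do 2!apply: measurable_funM => //.
pose bd (x : R) := expR (x ^+ 2 / (4 * Num.sqrt 2 ^+ 2)).
have mbd : measurable_fun [set: R] (EFin \o bd).
  apply/measurable_EFinP/measurableT_comp => //.
  by apply: measurable_funM => //; exact: measurable_funX.
have s20 : Num.sqrt 2 != 0 :> R by rewrite gt_eqF// sqrtr_gt0.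
set K := D ^+ 2 * r ^+ (2 * k).
have K0 : 0 <= K by rewrite mulr_ge0 ?exprn_ge0 ?ler0n// ltW.
rewrite unlock.
(* The spare 1/72 later absorbs the expectation sqrt 2 of [bd]. *)
apply: (@le_trans _ _ (\int[P]_w ((K / 72)%:E * (bd (w0 w))%:E))%E).
  apply: ae_ge0_le_integral => //.
  - by move=> w _; rewrite lee_fin sqr_ge0.
  - apply/measurable_EFinP/measurable_funX/measurable_funB => //.
    apply: measurableT_comp; first exact: measurable_tau.
    exact: measurable_funM.
  - by move=> w _; rewrite -EFinM lee_fin mulr_ge0 ?expR_ge0 ?divr_ge0.
  - apply: measurable_funeM.
    exact: (measurableT_comp mbd mw).
  apply: filterS (bernoulli_law_ae (vlaw ord0)) => w v01 _.
  rewrite -EFinM lee_fin.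
  have YE : obsY lambda v W ord0 ord0 w / lambda - v0 w = w0 w / lambda.
    have vv : v0 w * v0 w = v0 w.
      by rewrite /v0; case: v01 => ->; rewrite ?mulr0 ?mulr1.
    rewrite /obsY -/v0 -/w0 -mulrA vv mulrDl mulrAC divff ?gt_eqF// mul1r.
    by rewrite addrAC subrr add0r.
  have /= := tau_dist k (obsY lambda v W ord0 ord0 w / lambda) v01.
  rewrite YE => dist.
  rewrite -real_normK ?num_real//.
  apply: (@le_trans _ _ ((((2 * k + 1) * 'C(2 * k, k))%:R *
      (`|w0 w / lambda| ^+ k.+1 * (1 + `|w0 w / lambda|) ^+ k)) ^+ 2)).
    by apply: lerXn2r => //; rewrite nnegrE (le_trans _ dist).
  rewrite /bd sqr_sqrtr//.
  apply: tau_bound_le_expR => //; rewrite ?(ltW r0) ?(ltW r1)//.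
    by rewrite divr_ge0 ?sqr_ge0.
  rewrite real_normK ?num_real// exprMn exprVn -/D.
  (* As 72 * 8 = 576, what remains is exactly the bound of [sqr_snr_ge]. *)
  have -> : r ^+ 2 / 72 * (w0 w ^+ 2 / (4 * 2)) = w0 w ^+ 2 * (r ^+ 2 / 576).
    by field.
  rewrite -mulrA ler_wpM2l ?sqr_ge0// mulrC ler_pdivrMr ?exprn_gt0//.
  lra.
rewrite ge0_integralZl//; last 3 first.
- exact: (measurableT_comp mbd mw).
- by move=> w _; rewrite lee_fin expR_ge0.
- by rewrite lee_fin divr_ge0.
rewrite (has_law_integral (mu := normal_prob 0 (Num.sqrt 2)) (Wlaw ord0)
  (f := EFin \o bd))//; last first.
  by move=> x; rewrite lee_fin expR_ge0.
rewrite integral_normal_expR_sqr// -EFinM lee_fin -mulrA ler_piMr//.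
have : Num.sqrt 2 <= 72 :> R.
  rewrite -[72]gtr0_norm// -sqrtr_sqr ler_sqrt//; lra.
by lra.
Qed.
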